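(* Let $0<\rho\le r_1$, $u_0=\phi_1c_3(\rho/4)^n$, $u_2=u_0/4$, $L>0$, and $h_0\in(0,1)$. With $N=N_0+N_1+N_2$ and index sets $I^{(0)}=\{1,\dots,N_0\}$, $I^{(1)}=\{N_0+1,\dots,N_0+N_1\}$, $I^{(2)}=\{N_0+N_1+1,\dots,N\}$, define for $j,j'\in I^{(0)}$, $k\in I^{(1)}$: $$T_{jk}=\sum_{\ell\in I^{(2)}}Y_{j\ell}Y_{k\ell},\qquad K^L_{jk}=\frac1{N_2}\sum_{\ell\in I^{(2)}}\big(\min(|\overline D_{j\ell}-\overline D_{k\ell}|^2,L)-2\sigma^2\big)Y_{j\ell}Y_{k\ell},$$ $$a_{j,j',k}=\beta_1\big(T_{jk}/(bN_2)\big)\,\psi_\rho(K^L_{jk})\,Y_{j'k},\quad W_{j,j'}=\frac1{N_1}\sum_{k\in I^{(1)}}a_{j,j',k},\quad V^2_{j,j'}=\frac1{N_1}\sum_{k\in I^{(1)}}a_{j,j',k}\,\eta_{kj'},$$ and $Q^2_{j,j'}=V^2_{j,j'}/W_{j,j'}$ when $W_{j,j'}>0$. Then $$\mathbb P\Big(\forall j,j'\in I^{(0)}:\ W_{j,j'}\ge u_2\ \Rightarrow\ |Q^2_{j,j'}|\le h_0\Big)\ \ge\ 1-2N_0^2\exp\big(-e^{-2\beta}N_1u_2h_0^2/4\big).$$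
   Context: Standing setup. $(M,g)$ is a compact connected smooth Riemannian manifold of dimension $n$ with $|\mathrm{Sec}_M|\le \Lambda^2$, $\mathrm{diam}(M)\le D$, $\mathrm{inj}(M)\ge i_0$; $d_M$ denotes the geodesic distance and $dV_g$ the Riemannian volume. $\mu$ is a Borel probability measure on $M$ with $\rho_{\min}\le d\mu/dV_g\le \rho_{\max}$. On a complete probability space, $X_1,\dots,X_N$ are i.i.d. $M$-valued random variables with law $\mu$; $\eta_{jk}$ ($j,k\in\{1,\dots,N\}$) are real random variables with $\mathbb E\eta_{jk}=0$, $\mathbb E\eta_{jk}^2=\sigma^2$, $\mathbb E e^{|\eta_{jk}|}=\beta$ ($\beta>1$); all the $X_j$ and $\eta_{jk}$ are independent. $D_{jk}=d_M(X_j,X_k)+\eta_{jk}$. $\Phi:M\times M\to[0,1]$ is measurable and there is a non-increasing $C^1$ function $\Phi^1:[0,\infty)\to[0,1]$ with $\Phi^1(0)=\phi_0$, $\|\Phi^1\|_{C^1}\le H$, and $c_1\Phi^1(d_M(x,y))\le \Phi(x,y)\le c_2\Phi^1(d_M(x,y))$ for all $x,y\in M$ ($0<c_1<1<c_2$). $Y_{jk}$ are $\{0,1\}$-valued random variables, independent of all $\eta_{j'k'}$ and of all $X_{j'}$ with $j'\notin\{j,k\}$, with $\mathbb P(Y_{jk}=1\mid X_j,X_k)=\Phi(X_j,X_k)$, and conditionally on $(X_1,\dots,X_N)$ the $Y_{jk}$ are independent. The partial data are $\overline D_{jk}=D_{jk}$ if $Y_{jk}=1$ and $\overline D_{jk}=$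 ''missing'' if $Y_{jk}=0$ (summands with $Y_{j\ell}Y_{k\ell}=0$ are $0$). Constants: $r_0=\min\big(\frac{\phi_0}{2H},i_0,\frac{\pi}{2\Lambda}\big)$, $r_1=r_0/2$, $\phi_1=c_1\phi_0/2$; $\omega_n$ volume of the unit ball of $\mathbb R^n$, $V_0$ volume of a ball of radius $D$ in $n$-dimensional hyperbolic space of curvature $-\Lambda^2$, $c_3=\frac{\rho_{\min}}{\rho_{\max}}\frac{\omega_n}{V_0}$, $c_4=c_3\phi_1^2r_1^n$, $b=c_4/2$. Cut-offs: $\psi_1\in C_0^\infty(\mathbb R)$ with $\mathrm{supp}\,\psi_1\subset(-2,2)$, $\psi_1=1$ on $[-1,1]$, $0\le\psi_1\le1$, $\psi_1$ even, $\|\psi_1\|_{C^1}\le2$, $\psi_1|_{[0,\infty)}$ non-increasing; $\psi_\rho(t)=\psi_1(t/\rho^2)$, $\beta_1=1-\psi_1$. *)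

(* Defs.v *)
From HB Require Import structures.
From mathcomp Require Import all_boot all_order all_algebra.
From mathcomp Require Import all_classical all_reals all_analysis.

Set Implicit Arguments.
Unset Strict Implicit.
Unset Printing Implicit Defensive.

Import Order.TTheory GRing.Theory Num.Theory.
Import numFieldNormedType.Exports.

Local Open Scope classical_set_scope.
Local Open Scope ring_scope.

Definition pr {d} {T : measurableType d} {R : realType}
  (P : probability T R) (A : set T) : R := fine (P A).

Fixpoint unit_ball_vol {R : realType} (n : nat) : R :=
  match n with
  | 0 => 1
  | 1 => 2
  | m.+2 => (2 * pi / m.+2%:R) * unit_ball_vol m
  end.

Definition sinhR {R : realType} (x : R) : R := (expR x - expR (- x)) / 2.

(* V_0 : volume of a ball of radius D in the n-dim. hyperbolic space of
   curvature -Lam^2 (geodesic polar coordinates) *)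
Definition hyp_ball_vol {R : realType} (n : nat) (Lam D : R) : R :=
  n%:R * unit_ball_vol n *
  Rintegral lebesgue_measure `[0, D]%classic
    (fun t => (sinhR (Lam * t) / Lam) ^+ n.-1).

Definition cutoff {R : realType} (psi : R -> R) : Prop :=
  [/\ (forall (k : nat) (x : R), derivable (derive1n k psi) x 1),
      closure [set t | psi t != 0] `<=` `](-2), 2[%classic,
      (forall t, -1 <= t -> t <= 1 -> psi t = 1),
      (forall t, 0 <= psi t /\ psi t <= 1) &
      (forall t, psi (- t) = psi t)] /\ [/\
      (* ||psi||_{C^1} = max (sup |psi|, sup |psi'|) <= 2 *)
      (forall t, `|psi t| <= 2 /\ `|derive1 psi t| <= 2) &
      (forall s t, 0 <= s -> s <= t -> psi t <= psi s)].

(* Phi^1 : a C^1 profile on [0,oo) (given as the restriction of a C^1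
   function on R), non-increasing, values in [0,1], Phi^1(0) = phi0,
   ||Phi^1||_{C^1} <= H (max convention) *)
Definition profile {R : realType} (Phi1 : R -> R) (phi0 H : R) : Prop :=
  [/\ (forall x : R, derivable Phi1 x 1),
      continuous (derive1 Phi1) &
      Phi1 0 = phi0] /\ [/\
      (forall x, 0 <= x -> 0 <= Phi1 x /\ Phi1 x <= 1),
      (forall x, 0 <= x -> `|Phi1 x| <= H /\ `|derive1 Phi1 x| <= H) &
      (forall s t, 0 <= s -> s <= t -> Phi1 t <= Phi1 s)].

Definition yv {T : Type} {R : realType} (Y : set T) (w : T) : R :=
  (w \in Y)%:R.

Definition data_model {dT dM} {Omega : measurableType dT}
  {M : measurableType dM} {R : realType} (N : nat)
  (P : probability Omega R) (mu : probability M R)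
  (distM : M -> M -> R) (Phi : M -> M -> R)
  (X : 'I_N -> Omega -> M) (eta : 'I_N -> 'I_N -> Omega -> R)
  (Y : 'I_N -> 'I_N -> set Omega) (sigma beta : R) : Prop :=
  [/\ (forall j, measurable_fun setT (X j)),
      (forall j k, measurable_fun setT (eta j k)) &
      (forall j k, measurable (Y j k))] /\ [/\
      (forall j (A : set M), measurable A -> P (X j @^-1` A) = mu A),
      (forall j k, [/\ (\int[P]_w (eta j k w)%:E = 0)%E,
                       (\int[P]_w ((eta j k w) ^+ 2)%:E = (sigma ^+ 2)%:E)%E &
                       (\int[P]_w (expR `|eta j k w|)%:E = beta%:E)%E]),
      (forall (A : 'I_N -> set M) (B : 'I_N -> 'I_N -> set R),
          (forall j, measurable (A j)) -> (forall j k, measurable (B j k)) ->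
          pr P ((\bigcap_(j in setT) (X j @^-1` A j)) `&`
                (\bigcap_(jk in setT) (eta jk.1 jk.2 @^-1` B jk.1 jk.2))) =
          (\prod_(j < N) pr P (X j @^-1` A j)) *
          \prod_(j < N) \prod_(k < N) pr P (eta j k @^-1` B j k)) &
      (* conditionally on (X_1..X_N), the Y_jk are independent Bernoulli
         (Phi(X_j,X_k)) variables, and the family Y is independent of the
         eta's: joint law of (X, eta, Y) *)
      (forall (A : 'I_N -> set M) (B : 'I_N -> 'I_N -> set R)
              (S : {set 'I_N * 'I_N}) (y : 'I_N -> 'I_N -> bool),
          (forall j, measurable (A j)) -> (forall j k, measurable (B j k)) ->
          let E := (\bigcap_(j in setT) (X j @^-1` A j)) `&`
                   (\bigcap_(jk in setT) (eta jk.1 jk.2 @^-1` B jk.1 jk.2)) in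
          (P (E `&` \bigcap_(p in [set p | p \in S])
                       [set w | (w \in Y p.1 p.2) = y p.1 p.2]) =
           \int[P]_(w in E)
              (\prod_(p in S)
                 (if y p.1 p.2 then Phi (X p.1 w) (X p.2 w)
                  else 1 - Phi (X p.1 w) (X p.2 w)))%:E)%E)].

(* ---- the quantities of the lemma; indices are 0-based:
   I0 = [0, N0), I1 = [N0, N0+N1), I2 = [N0+N1, N0+N1+N2) ---- *)
Section Quantities.
Context {T M : Type} {R : realType} (N0 N1 N2 : nat).
Local Notation N := (N0 + N1 + N2)%N.
Context (distM : M -> M -> R) (X : 'I_N -> T -> M)
  (eta : 'I_N -> 'I_N -> T -> R) (Y : 'I_N -> 'I_N -> set T).

Definition Dv (j k : 'I_N) (w : T) : R := distM (X j w) (X k w) + eta j k w.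

Definition Tjk (j k : 'I_N) (w : T) : R :=
  \sum_(l < N | (N0 + N1 <= l)%N) yv (Y j l) w * yv (Y k l) w.

Definition KL (L sigma : R) (j k : 'I_N) (w : T) : R :=
  N2%:R^-1 * \sum_(l < N | (N0 + N1 <= l)%N)
     (Num.min (`|Dv j l w - Dv k l w| ^+ 2) L - 2 * sigma ^+ 2)
       * yv (Y j l) w * yv (Y k l) w.

Definition acoef (psi1 : R -> R) (b rho L sigma : R) (j j' k : 'I_N) (w : T)
  : R :=
  (1 - psi1 (Tjk j k w / (b * N2%:R))) * psi1 (KL L sigma j k w / rho ^+ 2)
  * yv (Y j' k) w.

Definition Wjj (psi1 : R -> R) (b rho L sigma : R) (j j' : 'I_N) (w : T) : R :=
  N1%:R^-1 * \sum_(k < N | (N0 <= k < N0 + N1)%N)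
     acoef psi1 b rho L sigma j j' k w.

Definition V2jj (psi1 : R -> R) (b rho L sigma : R) (j j' : 'I_N) (w : T)
  : R :=
  N1%:R^-1 * \sum_(k < N | (N0 <= k < N0 + N1)%N)
     acoef psi1 b rho L sigma j j' k w * eta k j' w.

Definition Q2jj (psi1 : R -> R) (b rho L sigma : R) (j j' : 'I_N) (w : T)
  : R :=
  V2jj psi1 b rho L sigma j j' w / Wjj psi1 b rho L sigma j j' w.

End Quantities.

Arguments Dv {T M R} N0 N1 N2 distM X eta j k w.
Arguments Tjk {T R} N0 N1 N2 Y j k w.
Arguments KL {T M R} N0 N1 N2 distM X eta Y L sigma j k w.
Arguments acoef {T M R} N0 N1 N2 distM X eta Y psi1 b rho L sigma j j' k w.
Arguments Wjj {T M R} N0 N1 N2 distM X eta Y psi1 b rho L sigma j j' w.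
Arguments V2jj {T M R} N0 N1 N2 distM X eta Y psi1 b rho L sigma j j' w.
Arguments Q2jj {T M R} N0 N1 N2 distM X eta Y psi1 b rho L sigma j j' w.

(* Main.v *)
Require Import Defs.
From HB Require Import structures.
From mathcomp Require Import all_boot all_order all_algebra.
From mathcomp Require Import all_classical all_reals all_analysis.
From mathcomp Require Import measurable_realfun ring lra.
Import Order.TTheory GRing.Theory Num.Theory.
Import numFieldNormedType.Exports.
Local Open Scope classical_set_scope.
Local Open Scope ring_scope.

(* Fix [j] and [j'] and write [a_k], [eta_k] for the weights and the noises
   [eta_{k j'}], [k] in [I1]. The weights lie in [0, 1] and only involve [X], [Y]
   and the noises [eta_{. l}] with [l] in [I2], so each [eta_k] is independent of
   all the weights and of the other [eta_k']. For [|s| <= 1/4] one has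
   [E exp (s eta_k) <= exp (4 beta s^2)]; integrating out the noises one at a time,
   [exp (lam sum_k a_k eta_k - 4 beta lam^2 sum_k a_k)] has expectation at most [1]
   whenever [|lam| <= 1/4]. With [lam = h0 / (8 beta)] or its opposite, Markov's
   inequality bounds the probability that [|sum_k a_k eta_k| > h0 sum_k a_k] and
   [sum_k a_k >= N1 u2] by [2 exp (- N1 u2 h0^2 / (16 beta))], and
   [exp (- 2 beta) <= 1 / (4 beta)]. A union bound over [(j, j')] concludes. *)

(** * Measurability of finite sums and of comparison events *)

Lemma measurable_sum_seq {R : realType} {d : measure_display}
    {T : measurableType d} (D : set T) (I : eqType) (s : seq I)
    (h : I -> T -> R) :
  (forall i, i \in s -> measurable_fun D (h i)) ->
  measurable_fun D (fun x => \sum_(i <- s) h i x).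
Proof.
elim: s => [_|i s IH mh].
  by under eq_fun do rewrite big_nil//=; exact: measurable_cst.
under eq_fun do rewrite big_cons//=; apply: measurable_funD.
- by apply: mh; rewrite mem_head.
- by apply: IH => k ks; apply: mh; rewrite inE ks orbT.
Qed.

Lemma measurable_set_ler {R : realType} {d : measure_display}
    {T : measurableType d} (f g : T -> R) :
  measurable_fun setT f -> measurable_fun setT g ->
  measurable [set w | f w <= g w].
Proof.
move=> mf mg; rewrite -[X in measurable X]setTI.
exact: (measurable_fun_ler mf mg measurableT (Y := [set true]) I).
Qed.

Lemma measurable_set_ltr {R : realType} {d : measure_display}
    {T : measurableType d} (f g : T -> R) :
  measurable_fun setT f -> measurable_fun setT g ->
  measurable [set w | f w < g w].
Proof.
move=> mf mg; rewrite -[X in measurable X]setTI.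
exact: (measurable_fun_ltr mf mg measurableT (Y := [set true]) I).
Qed.

(** * Independence of a map from a sigma-algebra, and integration by freezing *)

Definition independent_maps {R : realType} {d d1 d2 : measure_display}
  {T : measurableType d} {E : measurableType d1} {F : measurableType d2}
  (P : probability T R) (U : T -> E) (V : T -> F) : Prop :=
  forall A B, measurable A -> measurable B ->
    P (U @^-1` A `&` V @^-1` B) = (P (U @^-1` A) * P (V @^-1` B))%E.

Section independence.
Context {R : realType} {d : measure_display} {T : measurableType d}.
Variable P : probability T R.
Local Open Scope ereal_scope.

(** For fixed [B], the two sides are finite measures in [A]: a restriction of [P] and a constant
    multiple of [P]. They agree on a pi-system containing the whole space, hence on the
    sigma-algebra it generates. Taking the identity into [g_sigma_algebraType G] as first map
    encodes independence from that sigma-algebra. *)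
Lemma independent_pi_system (G : set (set T)) d' (F : measurableType d')
    (V : T -> F) : measurable_fun setT V ->
  G `<=` measurable -> setI_closed G -> G setT ->
  (forall A B, G A -> measurable B ->
     P (A `&` V @^-1` B) = P A * P (V @^-1` B)) ->
  independent_maps P (id : T -> g_sigma_algebraType G) V.
Proof.
move=> mV Gm GI GT GV A B mA mB.
have mVB : measurable (V @^-1` B) by rewrite -[X in measurable X]setTI; exact: mV.
have p0 : (0 <= fine (P (V @^-1` B)))%R by exact: fine_ge0.
pose m2 := mscale (NngNum p0) P.
have m2E C : m2 C = P C * P (V @^-1` B).
  by rewrite /m2 /mscale/= fineK ?fin_num_measure// muleC.
rewrite -m2E.
apply: (g_sigma_algebra_measure_unique G Gm (fun=> setT) _ _ (mrestr P mVB) m2) => //.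
- by rewrite bigcup_const.
- by move=> C GC; transitivity (P C * P (V @^-1` B)); [exact: GV|exact/esym/m2E].
- by move=> _; apply: (le_lt_trans (probability_le1 P (measurableI _ _ measurableT mVB))); rewrite ltry.
Qed.

(** The law of [(U, V)] and the product of the two laws agree on rectangles, hence everywhere;
    Tonelli and two changes of variables do the rest. *)
Lemma ge0_integral_independent d1 d2 (E : measurableType d1)
    (F : measurableType d2) (U : T -> E) (V : T -> F) (f : E * F -> \bar R) :
  measurable_fun setT U -> measurable_fun setT V -> independent_maps P U V ->
  measurable_fun setT f -> (forall z, 0 <= f z) ->
  \int[P]_w f (U w, V w) = \int[P]_w \int[P]_w' f (U w, V w').
Proof.
move=> mU mV UV mf f0.
pose U' : {mfun T >-> E} := HB.pack U (isMeasurableFun.Build _ _ _ _ _ mU).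
pose V' : {mfun T >-> F} := HB.pack V (isMeasurableFun.Build _ _ _ _ _ mV).
have mUV : measurable_fun setT (fun w => (U w, V w)) by exact: measurable_fun_pair.
transitivity (\int[pushforward P (fun w => (U w, V w))]_z f z).
  by rewrite ge0_integral_pushforward.
transitivity (\int[distribution P U' \x distribution P V']_z f z).
  apply: eq_measure_integral => A mA _; apply/esym.
  exact: product_measure_unique.
rewrite fubini_tonelli1// /fubini_F/= ge0_integral_pushforward//=.
- apply: eq_integral => w _ /=; rewrite ge0_integral_pushforward//=.
  exact: measurable_fun_pair2.
- exact: (@measurable_fun_fubini_tonelli_F _ _ _ _ _ (distribution P V') f mf f0).
- by move=> *; exact: integral_ge0.
Qed.

(** The form used to integrate out one noise [V]: a bound proved with the other data frozen at [u]
    survives integration. *)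
Lemma ge0_le_integral_independent d1 d2 (E : measurableType d1)
    (F : measurableType d2) (U : T -> E) (V : T -> F) (f : E * F -> \bar R)
    (g : E -> \bar R) :
  measurable_fun setT U -> measurable_fun setT V -> independent_maps P U V ->
  measurable_fun setT f -> (forall z, 0 <= f z) -> measurable_fun setT g ->
  (forall u, \int[P]_w f (u, V w) <= g u) ->
  \int[P]_w f (U w, V w) <= \int[P]_w g (U w).
Proof.
move=> mU mV UV mf f0 mg fg; rewrite ge0_integral_independent//.
apply: ge0_le_integral => //.
- by move=> w _; exact: integral_ge0.
(* Pulling the second variable back to [T] lets Tonelli give measurability of the inner integral
   with respect to [P] itself. *)
- pose f' (z : E * T) := f (z.1, V z.2).
  have mf' : measurable_fun setT f'.
    apply: measurableT_comp => //; apply: measurable_fun_pair => //.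
    exact: measurableT_comp.
  have mF := @measurable_fun_fubini_tonelli_F _ _ _ _ _ P f' mf' (fun=> f0 _).
  exact: (measurableT_comp mF mU).
- exact: measurableT_comp.
Qed.

End independence.

(** * Exponential moment of a centred noise *)

Section exponential_moment.
Context {R : realType}.

(** Put [u = s x] in [exp u <= 1 + u + u^2 exp |u|]. Since [|u| <= |x| / 4], a part [3/4] of the
    exponent [|x|] is left to absorb [x^2]. *)
Lemma expR_le_quadratic (s x : R) : `|s| <= 4^-1 ->
  expR (s * x) <= 1 + s * x + 4 * s ^+ 2 * expR `|x|.
Proof.
move=> s4.
(* From [exp u - 1 <= u exp u] one gets [exp u - 1 - u <= u (exp u - 1)]. The right side is at most
   [u^2 exp u] for [u >= 0], and at most [u^2] for [u < 0] because [exp u - 1 >= u]. *)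
have exp_sq (u : R) : expR u <= 1 + u + u ^+ 2 * expR `|u|.
  have eN := expR_ge1Dx (- u); have e := expR_ge1Dx u; have p := expR_gt0 u.
  have h : expR u - 1 <= u * expR u.
    have : (1 + - u) * expR u <= 1.
      by rewrite -[leRHS](expR0) -(addNr u) expRD ler_pM2r.
    by lra.
  have [u0|u0] := leP 0 u.
    rewrite ger0_norm//; nra.
  have q : 1 <= expR `|u| by rewrite -[leLHS]expR0 ler_expR.
  have : u * (expR u - 1) <= u ^+ 2 by nra.
  have : u ^+ 2 <= u ^+ 2 * expR `|u| by rewrite ler_peMr// sqr_ge0.
  by lra.
(* [exp y] is the cube of [exp (y / 3) >= 1 + y / 3]; in the expansion, the cubic term is bounded
   below through [y (y - 3)^2 >= 0]. *)
have cube (y : R) : 0 <= y -> y ^+ 2 <= 2 * expR y.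
  move=> y0.
  have -> : expR y = expR (y / 3) ^+ 3.
    by rewrite -expRM_natl; congr expR; lra.
  have h := expR_ge1Dx (y / 3).
  have : (1 + y / 3) ^+ 3 <= expR (y / 3) ^+ 3.
    by apply: lerXn2r => //; rewrite ?nnegrE ?expR_ge0//; lra.
  suff : y ^+ 2 <= 2 * (1 + y / 3) ^+ 3 by lra.
  have -> : 2 * (1 + y / 3) ^+ 3 = 2 + 2 * y + 2 / 3 * y ^+ 2 + 2 / 27 * y ^+ 3.
    by field.
  have : 0 <= y * (y - 3) ^+ 2 by rewrite mulr_ge0// sqr_ge0.
  have := sqr_ge0 (y - 3).
  by nra.
apply: (le_trans (exp_sq _)); rewrite lerD2l exprMn normrM.
rewrite [4 * _]mulrC -![_ ^+ 2 * _ * _]mulrA ler_wpM2l ?sqr_ge0//.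
have x0 : 0 <= `|x| by [].
have y2 : (3 / 4 * `|x|) ^+ 2 <= 2 * expR (3 / 4 * `|x|) by apply: cube; lra.
have -> : 4 * expR `|x| = 4 * expR (3 / 4 * `|x|) * expR (4^-1 * `|x|).
  by rewrite -mulrA -expRD; congr (_ * expR _); lra.
apply: ler_pM; rewrite ?sqr_ge0 ?expR_ge0//.
  have -> : x ^+ 2 = `|x| ^+ 2 by rewrite real_normK// num_real.
  have -> : `|x| ^+ 2 = 16 / 9 * (3 / 4 * `|x|) ^+ 2 by field.
  have := expR_gt0 (3 / 4 * `|x|); lra.
by rewrite ler_expR ler_wpM2r.
Qed.

(** Integrate the quadratic bound: the linear term has mean zero, the last term contributes
    [4 s^2 beta], and [1 + t <= exp t]. *)
Lemma expR_moment_le d (T : measurableType d) (P : probability T R)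
    (eta : T -> R) (beta s : R) : measurable_fun setT eta ->
  (\int[P]_w (eta w)%:E = 0)%E ->
  (\int[P]_w (expR `|eta w|)%:E = beta%:E)%E ->
  `|s| <= 4^-1 ->
  (\int[P]_w (expR (s * eta w))%:E <= (expR (4 * beta * s ^+ 2))%:E)%E.
Proof.
move=> meta eta0 etab s4.
have mexp : measurable_fun setT (fun w => expR `|eta w|).
  by apply: measurableT_comp => //; exact: measurableT_comp.
have iexp : P.-integrable setT (fun w => (expR `|eta w|)%:E).
  apply/integrableP; split; first exact/measurable_EFinP.
  under eq_integral do rewrite gee0_abs ?lee_fin ?expR_ge0//.
  by rewrite etab ltry.
have ieta : P.-integrable setT (fun w => (eta w)%:E).
  apply: le_integrable iexp => //; first exact/measurable_EFinP.
  move=> w _; rewrite !abse_EFin lee_fin [leRHS]ger0_norm ?expR_ge0//.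
  by apply: le_trans (expR_ge1Dx _); rewrite lerDr.
have i1 : P.-integrable setT (fun=> 1%E).
  exact: finite_measure_integrable_cst.
apply: (@le_trans _ _ (\int[P]_w (1 + (s%:E * (eta w)%:E +
   (4 * s ^+ 2)%:E * (expR `|eta w|)%:E)))%E).
  apply: ge0_le_integral => //.
  - by apply/measurable_EFinP; apply: measurableT_comp => //; exact: measurable_funM.
  - apply: emeasurable_funD => //; apply: emeasurable_funD.
      by apply: emeasurable_funM => //; exact/measurable_EFinP.
    by apply: emeasurable_funM => //; exact/measurable_EFinP.
  - move=> w _; rewrite -!EFinM -!EFinD lee_fin addrA.
    exact: expR_le_quadratic.
rewrite integralD//; last first.
  by apply: integrableD => //; exact: integrableZl.
rewrite integralD//; [|exact: integrableZl..].
rewrite !integralZl// eta0 etab mule0 add0e integral_cst//.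
rewrite [X in (1 * X + _)%E](_ : _ = 1%E); last exact: probability_setT.
rewrite mule1.
rewrite -EFinM -EFinD lee_fin.
by apply: le_trans (expR_ge1Dx _); rewrite lerD2l; lra.
Qed.

End exponential_moment.

(** * Tail of a weighted sum of noises *)

Section weighted_noise.
Context {R : realType} {d : measure_display} {T : measurableType d}.
Context (P : probability T R) (I : eqType) (Q : pred I).
Context (a xi : I -> T -> R) (beta : R).
Hypothesis beta_gt1 : 1 < beta.
Hypothesis a01 : forall k w, 0 <= a k w <= 1.
Hypothesis ma : forall k, Q k -> measurable_fun setT (a k).
Hypothesis mxi : forall k, measurable_fun setT (xi k).
Hypothesis xi_mean : forall k, (\int[P]_w (xi k w)%:E = 0)%E.
Hypothesis xi_exp : forall k, (\int[P]_w (expR `|xi k w|)%:E = beta%:E)%E.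
(** Each noise has its own sigma-algebra [G], independent of it and rich enough to carry all the
    weights, [a k] included, and all the other noises. *)
Hypothesis xi_indep : forall k, Q k -> exists G : set (set T),
  [/\ G `<=` measurable,
      independent_maps P (id : T -> g_sigma_algebraType G) (xi k),
      (forall k', Q k' ->
         measurable_fun setT (a k' : g_sigma_algebraType G -> R)) &
      (forall k', Q k' -> k' != k ->
         measurable_fun setT (xi k' : g_sigma_algebraType G -> R))].

(** Induction on [s]: with the sigma-algebra of the head [k] frozen, only [xi k] is random. Its
    moment bound at [lam * a k] costs [4 beta lam^2 (a k)^2], which the compensator
    [4 beta lam^2 a k] covers because [0 <= a k <= 1]. Uniqueness of [s] keeps [xi k] out of the
    tail. *)
Lemma expR_weighted_moment_le1 (lam : R) (s : seq I) :
  `|lam| <= 4^-1 -> uniq s -> all Q s ->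
  (\int[P]_w (expR (\sum_(k <- s)
     (lam * (a k w * xi k w) - 4 * beta * lam ^+ 2 * a k w)))%:E <= 1)%E.
Proof.
move=> lam4; elim: s => [|k s IH] /=.
  move=> _ _; under eq_integral do rewrite big_nil expR0.
  by rewrite integral_cst// mul1e; apply: probability_le1.
move=> /andP[ks us] /andP[Qk Qs]; apply: le_trans (IH us Qs).
have [G [Gm indep aG xiG]] := xi_indep k Qk.
pose GT : measurableType G.-sigma := g_sigma_algebraType G.
pose g (w : GT) := expR (\sum_(i <- s)
     (lam * (a i w * xi i w) - 4 * beta * lam ^+ 2 * a i w)).
have mg : measurable_fun setT g.
  rewrite /g; apply: measurableT_comp => //.
  apply: measurable_sum_seq => i is_.
  have Qi : Q i by exact: (allP Qs).
  have ik : i != k by apply: contraNneq ks => <-.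
  apply: measurable_funB; apply: measurable_funM => //; last exact: aG.
  by apply: measurable_funM; [exact: aG|exact: xiG].
(* The first variable carries the weights and the remaining noises, the second stands for the value
   of [xi k]. *)
pose f (z : GT * R) :=
  expR (lam * (a k z.1 * z.2) - 4 * beta * lam ^+ 2 * a k z.1) * g z.1.
have mak1 : measurable_fun setT (fun z : GT * R => a k z.1).
  by apply: (measurableT_comp (aG k Qk)).
have mf : measurable_fun setT f.
  apply: measurable_funM; last exact: (measurableT_comp mg).
  apply: measurableT_comp => //; apply: measurable_funB; apply: measurable_funM => //.
  exact: measurable_funM.
have mid : measurable_fun setT (id : T -> GT).
  move=> _ A mA; rewrite setTI preimage_id.
  by apply: (smallest_sub (@sigma_algebra_measurable _ T) Gm).
rewrite [leLHS](_ : _ = (\int[P]_w (f ((id : T -> GT) w, xi k w))%:E)%E); last first.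
  by apply: eq_integral => w _; rewrite big_cons expRD.
apply: (@ge0_le_integral_independent _ _ _ P _ _ GT _ (id : T -> GT) (xi k)
   (fun z => (f z)%:E) (fun u => (g u)%:E)) => //.
- exact/measurable_EFinP.
- by move=> z; rewrite lee_fin mulr_ge0// expR_ge0.
- exact/measurable_EFinP.
move=> u; have /andP[au0 au1] := a01 k u.
pose c := expR (- (4 * beta * lam ^+ 2 * a k u)) * g u.
have c0 : 0 <= c by rewrite mulr_ge0// expR_ge0.
under eq_integral => w _.
  have -> : f (u, xi k w) = c * expR ((lam * a k u) * xi k w).
    by rewrite /f /c /= addrC expRD mulrA; ring.
  rewrite EFinM; over.
rewrite ge0_integralZl_EFin//; last first.
  by apply/measurable_EFinP; apply: measurableT_comp => //; exact: measurable_funM.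
have := @expR_moment_le _ _ _ P (xi k) beta (lam * a k u) (mxi k) (xi_mean k) (xi_exp k).
have -> : `|lam * a k u| <= 4^-1.
  by rewrite normrM (ger0_norm au0) (le_trans _ lam4)// ler_piMr.
move=> /(_ isT) /(lee_wpmul2l (x := c%:E)); rewrite lee_fin => /(_ c0) /le_trans; apply.
rewrite -EFinM lee_fin /c mulrAC -expRD -[leRHS]mul1r ler_pM2r ?expR_gt0//.
rewrite -[leRHS]expR0 ler_expR exprMn.
have a2 : a k u ^+ 2 <= a k u by rewrite expr2 ler_piMr.
have c1 : 0 <= 4 * beta * lam ^+ 2.
  by rewrite mulr_ge0 ?sqr_ge0// mulr_ge0// ltW// (lt_trans ltr01).
by have := ler_wpM2l c1 a2; lra.
Qed.

Lemma weighted_noise_one_sided_tail (b : bool) (s : seq I) (u h : R) :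
  uniq s -> all Q s -> 0 < h <= 1 ->
  measurable [set w | (u <= \sum_(k <- s) a k w) /\
      (h * \sum_(k <- s) a k w < (-1) ^+ b * \sum_(k <- s) a k w * xi k w)%R] /\
  (P [set w | (u <= \sum_(k <- s) a k w)%R /\
      (h * \sum_(k <- s) a k w < (-1) ^+ b * \sum_(k <- s) a k w * xi k w)%R]
   <= (expR (- (expR (- 2 * beta) * u * h ^+ 2 / 4)))%:E)%E.
Proof.
move=> us Qs /andP[h0 h1].
set A := [set w | _]; set e := expR (- 2 * beta) * u * h ^+ 2 / 4.
(* Up to its sign, [lam] maximises [lam h - 4 beta lam^2], with value [h^2 / (16 beta)];
   [h <= 1 < beta] keeps it within the range [1/4]. *)
pose lam := (-1) ^+ b * (h / (8 * beta)) : R.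
have b1 := beta_gt1; have b0 : 0 < beta by lra.
have lam4 : `|lam| <= 4^-1.
  rewrite normrM normr_sign mul1r ger0_norm ?divr_ge0 ?mulr_ge0//; try lra.
  rewrite ler_pdivrMr; lra.
have msum (f : I -> T -> R) : (forall k, Q k -> measurable_fun setT (f k)) ->
    measurable_fun setT (fun w => \sum_(k <- s) f k w).
  move=> mf; apply: measurable_sum_seq => i is_.
  by apply: mf; exact: (allP Qs).
have ma' := msum a ma.
have max : measurable_fun setT (fun w => \sum_(k <- s) a k w * xi k w).
  by apply: msum => k Qk; apply: measurable_funM => //; exact: ma.
have mA : measurable A.
  rewrite (_ : A = [set w | u <= \sum_(k <- s) a k w] `&`
    [set w | h * \sum_(k <- s) a k w < (-1) ^+ b * \sum_(k <- s) a k w * xi k w])//.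
  apply: measurableI; first exact: measurable_set_ler.
  by apply: measurable_set_ltr; exact: measurable_funM.
split=> //.
have Z1 := expR_weighted_moment_le1 lam s lam4 us Qs.
set Z := fun w => _ in Z1.
have mZ : measurable_fun setT Z.
  apply/measurable_EFinP; apply: measurableT_comp => //.
  apply: msum => k Qk; apply: measurable_funB; apply: measurable_funM => //;
    [apply: measurable_funM => //|]; exact: ma.
(* Markov's inequality: [Z] is at least [exp e] on [A] and has integral at most [1]. *)
have AZ : ((expR e)%:E * P A <= 1)%E.
  apply: le_trans Z1; rewrite -integral_cst//.
  apply: (@le_trans _ _ (\int[P]_(w in A) Z w)%E); last first.
    by apply: ge0_subset_integral => // w _; rewrite lee_fin expR_ge0.
  apply: ge0_le_integral => //.
  - by move=> w _; rewrite lee_fin expR_ge0.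
  - exact: measurable_funTS.
  move=> w [uS hS]; rewrite lee_fin ler_expR.
  set S := \sum_(k <- s) a k w in uS hS.
  set V := \sum_(k <- s) a k w * xi k w in hS.
  have S0 : 0 <= S by apply: sumr_ge0 => k _; have /andP[] := a01 k w.
  rewrite big_split/= -mulr_sumr sumrN -mulr_sumr -/S -/V.
  have lam2 : lam ^+ 2 = (h / (8 * beta)) ^+ 2.
    by rewrite exprMn sqrr_sign mul1r.
  have -> : 4 * beta * lam ^+ 2 * S = h ^+ 2 / (16 * beta) * S.
    by rewrite lam2; field; lra.
  have lamV : h ^+ 2 / (8 * beta) * S <= lam * V.
    have -> : lam * V = h / (8 * beta) * ((-1) ^+ b * V) by rewrite /lam; ring.
    have -> : h ^+ 2 / (8 * beta) * S = h / (8 * beta) * (h * S) by field; lra.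
    by rewrite ler_wpM2l ?(ltW hS)// divr_ge0// ?mulr_ge0//; lra.
  rewrite (_ : h ^+ 2 / (8 * beta) * S = 2 * (h ^+ 2 / (16 * beta) * S)) in lamV;
    last by field; lra.
  (* [exp (2 beta) = (exp beta)^2 >= (1 + beta)^2 >= 4 beta]. *)
  have eb : expR (- 2 * beta) <= (4 * beta)^-1.
    rewrite mulNr expRN lef_pV2 ?posrE ?expR_gt0//; last lra.
    have -> : 2 * beta = beta + beta by lra.
    rewrite expRD; have := expR_ge1Dx beta; nra.
  have : e <= h ^+ 2 / (16 * beta) * S.
    have -> : h ^+ 2 / (16 * beta) * S = (4 * beta)^-1 * S * (h ^+ 2 / 4).
      by field; lra.
    have -> : e = expR (- 2 * beta) * u * (h ^+ 2 / 4) by rewrite /e mulrA.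
    rewrite ler_wpM2r ?divr_ge0 ?sqr_ge0//.
    (* Passing from [u] to [S] first makes the factor nonnegative before the constant is
       enlarged. *)
    apply: (@le_trans _ _ (expR (- 2 * beta) * S)).
      by rewrite ler_wpM2l ?expR_ge0.
    by rewrite ler_wpM2r.
  lra.
move: AZ; rewrite -(@fineK _ (P A)) ?fin_num_measure// -EFinM !lee_fin => AZ.
by rewrite expRN -[leRHS]mulr1 ler_pdivlMl ?expR_gt0.
Qed.

Lemma weighted_noise_tail (s : seq I) (u h : R) :
  uniq s -> all Q s -> 0 < h <= 1 ->
  measurable [set w | (u <= \sum_(k <- s) a k w) /\
      (h * \sum_(k <- s) a k w < `|\sum_(k <- s) a k w * xi k w|)%R] /\
  (P [set w | (u <= \sum_(k <- s) a k w)%R /\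
      (h * \sum_(k <- s) a k w < `|\sum_(k <- s) a k w * xi k w|)%R]
   <= (2 * expR (- (expR (- 2 * beta) * u * h ^+ 2 / 4)))%:E)%E.
Proof.
move=> us Qs h01.
have [mA1 A1] := weighted_noise_one_sided_tail true s u h us Qs h01.
have [mA0 A0] := weighted_noise_one_sided_tail false s u h us Qs h01.
set A := [set w | _].
set B1 := [set w | _] in mA1 A1; set B0 := [set w | _] in mA0 A0.
have -> : A = B0 `|` B1.
  apply/seteqP; split => w; rewrite /A /B0 /B1/= ?expr0 ?expr1 mul1r mulN1r.
    by move=> [? ]; rewrite ltr_normr => /orP[]; [left|right].
  by move=> [] [? ?]; split => //; rewrite ltr_normr; apply/orP; [left|right].
split; first exact: measurableU.
apply: le_trans; first exact: measureU2.
by rewrite mulrDl mul1r EFinD leeD.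
Qed.

End weighted_noise.

(** * Cylinder events generating all the data except one noise *)

Definition cylinder {T M R : Type} {N : nat} (X : 'I_N -> T -> M)
  (eta : 'I_N -> 'I_N -> T -> R) (Y : 'I_N -> 'I_N -> set T)
  (A : 'I_N -> set M) (B : 'I_N -> 'I_N -> set R) (S : {set 'I_N * 'I_N})
  : set T :=
  [set w | [/\ forall j, A j (X j w), forall j k, B j k (eta j k w) &
               forall p, p \in S -> Y p.1 p.2 w]].

(* Prescribing only the events [Y j k], and not their complements, already
   gives an intersection-stable generator. *)
Definition cylinders {dM : measure_display} {M : measurableType dM}
  {R : realType} {T : Type} {N : nat} (X : 'I_N -> T -> M)
  (eta : 'I_N -> 'I_N -> T -> R) (Y : 'I_N -> 'I_N -> set T)
  (p0 : 'I_N * 'I_N) (S0 : {set 'I_N * 'I_N}) : set (set T) :=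
  [set C | exists A B (S : {set 'I_N * 'I_N}), [/\ forall j, measurable (A j),
     forall j k, measurable (B j k), B p0.1 p0.2 = setT, S \subset S0 &
     C = cylinder X eta Y A B S]].

Section cylinders.
Context {dM : measure_display} {M : measurableType dM} {R : realType}.
Context {dO : measure_display} {Omega : measurableType dO} {N : nat}.
Context {X : 'I_N -> Omega -> M} {eta : 'I_N -> 'I_N -> Omega -> R}.
Context {Y : 'I_N -> 'I_N -> set Omega}.
Implicit Types (S : {set 'I_N * 'I_N}).

Lemma measurable_cylinder A B S : (forall j, measurable_fun setT (X j)) ->
  (forall j k, measurable_fun setT (eta j k)) ->
  (forall j k, measurable (Y j k)) ->
  (forall j, measurable (A j)) -> (forall j k, measurable (B j k)) ->
  measurable (cylinder X eta Y A B S).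
Proof.
move=> mX meta mY mA mB.
rewrite (_ : cylinder _ _ _ _ _ _ =
   (\bigcap_(j in [set: 'I_N]) X j @^-1` A j) `&`
   (\bigcap_(p in [set: 'I_N * 'I_N]) eta p.1 p.2 @^-1` B p.1 p.2) `&`
   (\bigcap_(p in [set p | p \in S]) Y p.1 p.2)); last first.
  apply/seteqP; split => w /=.
    by move=> [Xw ew Yw]; split => //; split => [j _|p _] //=.
  move=> [[Xw ew] Yw]; split => [j|j k|//]; first exact: Xw.
  exact: (ew (j, k)).
apply: measurableI; first apply: measurableI.
- by apply: fin_bigcap_measurable => // j _; rewrite -[X in measurable X]setTI; exact: mX.
- by apply: fin_bigcap_measurable => // p _; rewrite -[X in measurable X]setTI; exact: meta.
- by apply: fin_bigcap_measurable => // p _; exact: mY.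
Qed.

Lemma cylindersI p0 S0 : setI_closed (cylinders X eta Y p0 S0).
Proof.
move=> _ _ [A [B [S [mA mB Bp SS0 ->]]]] [A' [B' [S' [mA' mB' Bp' SS0' ->]]]].
exists (fun j => A j `&` A' j), (fun j k => B j k `&` B' j k), (S :|: S').
split.
- by move=> j; exact: measurableI.
- by move=> j k; exact: measurableI.
- by rewrite Bp Bp' setTI.
- by rewrite finset.subUset SS0 SS0'.
apply/seteqP; split => w /=.
  move=> [[Aw Bw Sw] [Aw' Bw' Sw']]; split=> // p.
  by rewrite inE => /orP[/Sw|/Sw'].
move=> [Aw Bw Sw]; split; split => [j|j k|p pS].
- by have [] := Aw j.
- by have [] := Bw j k.
- by apply: Sw; rewrite inE pS.
- by have [] := Aw j.
- by have [] := Bw j k.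
- by apply: Sw; rewrite inE pS orbT.
Qed.

Lemma cylindersT p0 S0 : cylinders X eta Y p0 S0 setT.
Proof.
exists (fun=> setT), (fun _ _ => setT), finset.set0; split => //; first exact: finset.sub0set.
by apply/esym/seteqP; split => // w _; split => // p; rewrite finset.in_set0.
Qed.

Lemma measurable_cylinders_X p0 S0 j :
  measurable_fun setT (X j : g_sigma_algebraType (cylinders X eta Y p0 S0) -> M).
Proof.
move=> _ D mD; rewrite setTI; apply: sub_sigma_algebra.
exists (fun i => if i == j then D else setT), (fun _ _ => setT), finset.set0.
split => //; [by move=> i; case: ifP|exact: finset.sub0set|].
apply/seteqP; split => w /=.
  by move=> Dw; split=> // [i|p]; [case: eqP => // ->|rewrite finset.in_set0].
by move=> [/(_ j)]; rewrite eqxx.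
Qed.

Lemma measurable_cylinders_eta p0 S0 j k : (j, k) != p0 ->
  measurable_fun setT
    (eta j k : g_sigma_algebraType (cylinders X eta Y p0 S0) -> R).
Proof.
move=> jkp0 _ D mD; rewrite setTI; apply: sub_sigma_algebra.
exists (fun=> setT), (fun i l => if (i, l) == (j, k) then D else setT), finset.set0.
split => //.
- by move=> i l; case: ifP.
- by rewrite -surjective_pairing eq_sym (negPf jkp0).
- exact: finset.sub0set.
apply/seteqP; split => w /=.
  move=> Dw; split=> // [i l|p]; last by rewrite finset.in_set0.
  by case: eqP => // -[-> ->].
by move=> [_ /(_ j k)]; rewrite eqxx.
Qed.

Lemma measurable_cylinders_Y p0 S0 j k : (j, k) \in S0 ->
  measurable (Y j k : set (g_sigma_algebraType (cylinders X eta Y p0 S0))).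
Proof.
move=> jkS; apply: sub_sigma_algebra.
exists (fun=> setT), (fun _ _ => setT), [set (j, k)]%SET; split => //.
  by rewrite finset.sub1set.
apply/seteqP; split => w /=.
  by move=> Yw; split=> // p; rewrite inE => /eqP ->.
by move=> [_ _ /(_ (j, k))]; rewrite inE eqxx; apply.
Qed.

End cylinders.

(** * Independence of one noise from all the other data *)

Section noise_independence.
Context {dM : measure_display} {M : measurableType dM} {R : realType}.
Context {dO : measure_display} {Omega : measurableType dO} {N : nat}.
Context {X : 'I_N -> Omega -> M} {eta : 'I_N -> 'I_N -> Omega -> R}.
Context {Y : 'I_N -> 'I_N -> set Omega}.
Context {P : probability Omega R} {mu : probability M R}.
Context {distM : M -> M -> R} {Phi : M -> M -> R} {sigma beta : R}.
Hypothesis hmodel : data_model P mu distM Phi X eta Y sigma beta.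
Hypothesis mPhi : measurable_fun setT (fun p : M * M => Phi p.1 p.2).
Hypothesis Phi_ge0 : forall x y, 0 <= Phi x y.
Variable p0 : 'I_N * 'I_N.

Let mX j : measurable_fun setT (X j). Proof. by have [[]] := hmodel. Qed.
Let meta j k : measurable_fun setT (eta j k).
Proof. by have [[]] := hmodel. Qed.
Let mY j k : measurable (Y j k). Proof. by have [[]] := hmodel. Qed.

Lemma cylinders_measurable S0 : cylinders X eta Y p0 S0 `<=` measurable.
Proof. by move=> _ [A [B [S [mA mB _ _ ->]]]]; exact: measurable_cylinder. Qed.

(** Bridge to the shape of the events in [data_model]. *)
Lemma cylinder0E A B : cylinder X eta Y A B finset.set0 =
  (\bigcap_(j in setT) (X j @^-1` A j)) `&`
  (\bigcap_(jk in setT) (eta jk.1 jk.2 @^-1` B jk.1 jk.2)).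
Proof.
apply/seteqP; split => w /=.
  by move=> [Aw Bw _]; split => [j _|p _] /=.
move=> [Aw Bw]; split => [j|j k|p]; [exact: Aw|exact: (Bw (j, k))|].
by rewrite finset.in_set0.
Qed.

(** The slot [p0] is left free, so an event on that noise just fills it and the result is again a
    cylinder. *)
Lemma cylinder_setI_eta A B S C : B p0.1 p0.2 = setT ->
  cylinder X eta Y A B S `&` eta p0.1 p0.2 @^-1` C =
  cylinder X eta Y A (fun j k => if (j, k) == p0 then C else B j k) S.
Proof.
move=> Bp; apply/seteqP; split => w /=.
  by move=> [[Aw Bw Sw] Cw]; split => // j k; case: eqP => // jk; move: Cw; rewrite -jk.
move=> [Aw Bw Sw]; split; last first.
  by have := Bw p0.1 p0.2; rewrite -surjective_pairing eqxx.
split=> // j k; have := Bw j k; case: eqP => // jk _.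
by rewrite (_ : B j k = setT)// -Bp -jk.
Qed.

(** First stage, without any [Y]: the product formula of the model isolates the factor of [p0],
    which is [1] when that slot is free. *)
Lemma noise_independent_X_noise :
  independent_maps P
    (id : Omega -> g_sigma_algebraType (cylinders X eta Y p0 finset.set0))
    (eta p0.1 p0.2).
Proof.
apply: independent_pi_system => //.
- exact: cylinders_measurable.
- exact: cylindersI.
- exact: cylindersT.
move=> D C [A [B [S [mA mB Bp]]]]; rewrite finset.subset0 => /eqP -> -> {D} mC.
rewrite cylinder_setI_eta//; set B' := fun j k => _.
have mB' j k : measurable (B' j k) by rewrite /B'; case: ifP.
have [_ [_ _ hind _]] := hmodel.
have prE D : (forall j k, measurable (D j k)) ->
    pr P (cylinder X eta Y A D finset.set0) =
    (\prod_(j < N) pr P (X j @^-1` A j)) *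
    (pr P (eta p0.1 p0.2 @^-1` D p0.1 p0.2) *
     \prod_(p | p != p0) pr P (eta p.1 p.2 @^-1` D p.1 p.2)).
  move=> mD; rewrite cylinder0E hind//; congr (_ * _).
  by rewrite pair_bigA /= (bigD1 p0).
have finP D : measurable D -> P D = (pr P D)%:E.
  by move=> mD; rewrite /pr fineK// fin_num_measure.
have mcyl D : (forall j k, measurable (D j k)) ->
  measurable (cylinder X eta Y A D finset.set0) by move=> mD; exact: measurable_cylinder.
have mCe : measurable (eta p0.1 p0.2 @^-1` C).
  by rewrite -[X in measurable X]setTI; exact: meta.
rewrite !finP//; [|exact: mcyl..].
rewrite -EFinM; congr EFin; rewrite !prE// Bp.
rewrite preimage_setT [pr P setT](_ : _ = 1) ?mul1r; last first.
  by rewrite /pr probability_setT.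
rewrite {1}/B' -surjective_pairing eqxx [RHS]mulrC [RHS]mulrCA; congr (_ * (_ * _)).
by apply: eq_bigr => p pp0; rewrite /B' -surjective_pairing (negPf pp0).
Qed.

(** Second stage: prescribing events [Y] replaces a probability by the integral of a product of
    values of [Phi]. That integrand depends on [X] only, so the first stage separates it from the
    noise [p0]. *)
Lemma noise_independent_data :
  independent_maps P
    (id : Omega -> g_sigma_algebraType (cylinders X eta Y p0 finset.setT))
    (eta p0.1 p0.2).
Proof.
apply: independent_pi_system => //.
- exact: cylinders_measurable.
- exact: cylindersI.
- exact: cylindersT.
move=> D C [A [B [S [mA mB Bp _ ->]]]] {D} mC.
rewrite cylinder_setI_eta//; set B' := fun j k => _.
have mB' j k : measurable (B' j k) by rewrite /B'; case: ifP.
have [_ [_ _ _ hY]] := hmodel.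
pose g w := \prod_(p in S) Phi (X p.1 w) (X p.2 w).
have g0 w : 0 <= g w by apply: prodr_ge0.
(* The joint law with every prescribed [Y] required to occur, so only factors [Phi] and no [1 - Phi]
   appear. *)
have PE D : (forall j k, measurable (D j k)) ->
    (P (cylinder X eta Y A D S) =
     \int[P]_(w in cylinder X eta Y A D finset.set0) (g w)%:E)%E.
  move=> mD; rewrite [X in (\int[_]_(_ in X) _)%E]cylinder0E.
  rewrite -(hY A D S (fun _ _ => true))//; congr (P _).
  rewrite -cylinder0E; apply/seteqP; split => w /=.
    by move=> [Aw Dw Sw]; split; [split => // p; rewrite finset.in_set0|move=> p /= /Sw /mem_set].
  by move=> [[Aw Dw _] Sw]; split => // p /Sw /set_mem.
rewrite !PE// -cylinder_setI_eta//.
set E := cylinder X eta Y A B finset.set0.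
pose GT : measurableType _ := g_sigma_algebraType (cylinders X eta Y p0 finset.set0).
have mE : measurable (E : set GT).
  apply: sub_sigma_algebra; exists A, B, finset.set0; split=> //; exact: subxx.
have mg : measurable_fun setT (g : GT -> R).
  rewrite [g](_ : _ = fun w => \prod_p
      (if p \in S then Phi (X p.1 w) (X p.2 w) else 1)); last first.
    by apply/funext => w; rewrite /g big_mkcond.
  apply: measurable_prod => p _; case: (p \in S) => /=; last exact: measurable_cst.
  have mXX : measurable_fun setT (fun w : GT => (X p.1 w, X p.2 w)).
    by apply: measurable_fun_pair; exact: measurable_cylinders_X.
  exact: (measurableT_comp mPhi mXX).
(* The integrand as a function of the pair formed by the sigma-algebra without [Y] and the noise
   [p0], which is independent of it. *)
pose f (z : GT * R) := \1_E z.1 * g z.1 * \1_C z.2.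
have mf : measurable_fun setT f.
  apply: measurable_funM.
    apply: measurable_funM; last exact: (measurableT_comp mg).
    by apply: measurableT_comp => //; exact: measurable_indic.
  by apply: measurableT_comp => //; exact: measurable_indic.
have f0 z : 0 <= f z by rewrite !mulr_ge0.
have mid : measurable_fun setT (id : Omega -> GT).
  move=> _ D mD; rewrite setTI preimage_id.
  by apply: (smallest_sub (@sigma_algebra_measurable _ Omega) (@cylinders_measurable _)); exact: mD.
have mE' : measurable E by exact: measurable_cylinder.
have mCe : measurable (eta p0.1 p0.2 @^-1` C).
  by rewrite -[X in measurable X]setTI; exact: meta.
have mg' : measurable_fun setT g by exact: (measurableT_comp mg mid).
transitivity (\int[P]_w (f ((id : Omega -> GT) w, eta p0.1 p0.2 w))%:E)%E.
  rewrite integral_mkcond; apply: eq_integral => w _.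
  rewrite patchE /f /= !indicE in_setI; case: (w \in E) => /=; last by rewrite !mul0r.
  rewrite (_ : (w \in _ @^-1` C) = (eta p0.1 p0.2 w \in C))// mul1r.
  by case: (_ \in C); rewrite ?mulr1 ?mulr0.
rewrite (@ge0_integral_independent _ _ _ P _ _ GT _ id (eta p0.1 p0.2)
  (fun z => (f z)%:E))//; [|exact: noise_independent_X_noise|exact/measurable_EFinP].
have indE : (\int[P]_w (\1_C (eta p0.1 p0.2 w))%:E = P (eta p0.1 p0.2 @^-1` C))%E.
  by rewrite -(setIT (_ @^-1` C)) -integral_indic.
rewrite [X in (X * _)%E]integral_mkcond -ge0_integralZr//; last 2 first.
- by apply/(measurable_restrictT _ _).1 => //; apply/measurable_EFinP; exact: measurable_funTS.
- by move=> w _; apply: erestrict_ge0 => // u _; rewrite lee_fin.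
apply: eq_integral => w _ /=.
under eq_integral do rewrite /f /= EFinM.
rewrite ge0_integralZl_EFin//; last 2 first.
- apply/measurable_EFinP; apply: measurableT_comp => //; exact: measurable_indic.
- by rewrite mulr_ge0.
rewrite indE patchE indicE; case: (w \in E) => /=; rewrite ?mul1r//.
by rewrite mul0r !mul0e.
Qed.

End noise_independence.

(** * Union bound for a finite family; range and measurability of the weights *)

Lemma measurable_bigsetU_le_sum {R : realType} {d : measure_display}
    {T : measurableType d} (P : {measure set T -> \bar R}) (I : Type)
    (s : seq I) (F : I -> set T) : (forall i, measurable (F i)) ->
  measurable (\big[setU/set0]_(i <- s) F i) /\
  (P (\big[setU/set0]_(i <- s) F i) <= \sum_(i <- s) P (F i))%E.
Proof.
move=> mF; elim: s => [|i s [mU IH]].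
  by rewrite !big_nil measure0.
rewrite !big_cons; split; first exact: measurableU.
by apply: le_trans; [exact: measureU2|exact: leeD].
Qed.

Section acoef.
Context {R : realType} {dM : measure_display} {M : measurableType dM}.
Context {N0 N1 N2 : nat}.
Local Notation N := (N0 + N1 + N2)%N.
Context {distM : M -> M -> R} {psi1 : R -> R}.
Hypothesis psi1_cutoff : cutoff psi1.

Lemma cutoff_measurable : measurable_fun setT psi1.
Proof.
apply: continuous_measurable_fun => x; have [[dpsi _ _ _ _] _] := psi1_cutoff.
by apply: differentiable_continuous; apply/derivable1_diffP; exact: (dpsi 0%N).
Qed.

Lemma acoef_ge0_le1 {T : Type} (X : 'I_N -> T -> M)
    (eta : 'I_N -> 'I_N -> T -> R) (Y : 'I_N -> 'I_N -> set T)
    (b rho L sigma : R) (j j' k : 'I_N) (w : T) :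
  0 <= acoef N0 N1 N2 distM X eta Y psi1 b rho L sigma j j' k w <= 1.
Proof.
have [[_ _ _ psi01 _] _] := psi1_cutoff.
rewrite /acoef /yv; set x := Tjk _ _ _ _ _ _ _ / _; set y := KL _ _ _ _ _ _ _ _ _ _ _ _ / _.
have [x0 x1] := psi01 x; have [y0 y1] := psi01 y.
have q0 : 0 <= 1 - psi1 x by lra.
have q1 : 1 - psi1 x <= 1 by lra.
by case: (w \in _); rewrite ?mulr1 ?mulr0 ?ler01 ?lexx// mulr_ge0//= mulr_ile1.
Qed.

(** Noises are required measurable only in columns [l] of [I2], so this applies both on [Omega] and
    on the sigma-algebra that omits [eta k j'] with [j'] in [I0]. *)
Lemma measurable_acoef {d : measure_display} {T : measurableType d}
    (X : 'I_N -> T -> M)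
    (eta : 'I_N -> 'I_N -> T -> R) (Y : 'I_N -> 'I_N -> set T)
    (b rho L sigma : R) (j j' k : 'I_N) :
  measurable_fun setT (fun p : M * M => distM p.1 p.2) ->
  (forall i, measurable_fun setT (X i)) ->
  (forall i l : 'I_N, (N0 + N1 <= l)%N -> measurable_fun setT (eta i l)) ->
  (forall i l, measurable (Y i l)) ->
  measurable_fun setT
    (acoef N0 N1 N2 distM X eta Y psi1 b rho L sigma j j' k).
Proof.
move=> mdist mX meta mY.
have myv i l : measurable_fun setT (yv (Y i l) : T -> R).
  by rewrite (_ : yv _ = \1_(Y i l))//; exact: measurable_indic.
have mD (i l : 'I_N) : (N0 + N1 <= l)%N -> measurable_fun setT (Dv N0 N1 N2 distM X eta i l).
  move=> hl; apply: measurable_funD; last exact: meta.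
  have mXX : measurable_fun setT (fun w => (X i w, X l w)).
    exact: measurable_fun_pair.
  exact: (measurableT_comp mdist mXX).
have mpsi := cutoff_measurable.
apply: measurable_funM => //; apply: measurable_funM.
  apply: measurable_funB => //; apply: (measurableT_comp mpsi).
  apply: measurable_funM => //; rewrite /Tjk.
  under eq_fun do rewrite -big_filter.
  by apply: measurable_sum_seq => l _; exact: measurable_funM.
apply: (measurableT_comp mpsi); apply: measurable_funM => //.
apply: measurable_funM => //.
under eq_fun do rewrite -big_filter.
apply: measurable_sum_seq => l; rewrite mem_filter => /andP[hl _].
apply: measurable_funM => //; apply: measurable_funM => //.
apply: measurable_funB => //; apply: measurable_minr => //.
apply: measurable_funX; apply: measurableT_comp => //.
by apply: measurable_funB; exact: mD.
Qed.

End acoef.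

(** * Failure events for pairs [(j, j')] and the probability estimate *)

Theorem lemma4p2
  (R : realType)
  (* the "manifold": a measurable space with a distance and a volume *)
  (dM : measure_display) (M : measurableType dM)
  (distM : M -> M -> R) (vol : {measure set M -> \bar R})
  (n : nat) (Lam Dm i0 : R)
  (hn : (1 <= n)%N) (hLam : 0 < Lam) (hDm : 0 < Dm) (hi0 : 0 < i0)
  (hd_meas : measurable_fun setT (fun p : M * M => distM p.1 p.2))
  (hd0 : forall x y, distM x y = 0 <-> x = y)
  (hdsym : forall x y, distM x y = distM y x)
  (hdtri : forall x y z, distM x z <= distM x y + distM y z)
  (hdiam : forall x y, distM x y <= Dm)
  (* the sampling measure *)
  (mu : probability M R) (rho_min rho_max : R)
  (hrho_min : 0 < rho_min) (hrho : rho_min <= rho_max)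
  (hdens : exists f : M -> R, [/\ measurable_fun setT f,
       (forall x, rho_min <= f x /\ f x <= rho_max) &
       (forall A, measurable A -> mu A = (\int[vol]_(x in A) (f x)%:E)%E)])
  (* the observation probability Phi *)
  (Phi : M -> M -> R) (phi0 H c1 c2 : R)
  (hPhi_meas : measurable_fun setT (fun p : M * M => Phi p.1 p.2))
  (hPhi01 : forall x y, 0 <= Phi x y /\ Phi x y <= 1)
  (hc1 : 0 < c1) (hc1' : c1 < 1) (hc2 : 1 < c2)
  (hPhi1 : exists Phi1 : R -> R, profile Phi1 phi0 H /\
       forall x y, c1 * Phi1 (distM x y) <= Phi x y /\
                   Phi x y <= c2 * Phi1 (distM x y))
  (* the random data *)
  (dO : measure_display) (Omega : measurableType dO) (P : probability Omega R)
  (N0 N1 N2 : nat)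
  (X : 'I_(N0 + N1 + N2) -> Omega -> M)
  (eta : 'I_(N0 + N1 + N2) -> 'I_(N0 + N1 + N2) -> Omega -> R)
  (Y : 'I_(N0 + N1 + N2) -> 'I_(N0 + N1 + N2) -> set Omega)
  (sigma beta : R) (hbeta : 1 < beta)
  (hmodel : data_model P mu distM Phi X eta Y sigma beta)
  (* the cut-off *)
  (psi1 : R -> R) (hpsi1 : cutoff psi1)
  (* parameters of the lemma *)
  (rho L h0 : R) :
  let r0 := Num.min (phi0 / (2 * H)) (Num.min i0 (pi / (2 * Lam))) in
  let r1 := r0 / 2 in
  let phi1 := c1 * phi0 / 2 in
  let c3 := rho_min / rho_max * (unit_ball_vol n / hyp_ball_vol n Lam Dm) in
  let c4 := c3 * phi1 ^+ 2 * r1 ^+ n in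
  let b := c4 / 2 in
  0 < rho -> rho <= r1 -> 0 < L -> 0 < h0 -> h0 < 1 ->
  let u0 := phi1 * c3 * (rho / 4) ^+ n in
  let u2 := u0 / 4 in
  1 - 2 * (N0 ^ 2)%:R * expR (- (expR (- 2 * beta) * N1%:R * u2 * h0 ^+ 2 / 4))
  <= pr P [set w | forall j j' : 'I_(N0 + N1 + N2),
             (j < N0)%N -> (j' < N0)%N ->
             u2 <= Wjj N0 N1 N2 distM X eta Y psi1 b rho L sigma j j' w ->
             `|Q2jj N0 N1 N2 distM X eta Y psi1 b rho L sigma j j' w| <= h0].
Proof.
move=> r0 r1 phi1 c3 c4 b _ _ _ h0_gt0 h0_lt1; lazy zeta.
set u2 := phi1 * c3 * (rho / 4) ^+ n / 4.
set good := [set w | _].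
have [[mX meta mY] [_ eta_mom _ _]] := hmodel.
pose a j j' k := acoef N0 N1 N2 distM X eta Y psi1 b rho L sigma j j' k.
pose Q (k : 'I_(N0 + N1 + N2)) := (N0 <= k < N0 + N1)%N.
pose s := [seq k <- index_enum 'I_(N0 + N1 + N2) | Q k].
(* Failure at [(j, j')] with the denominators [N1] and [W] cleared, which is the shape of the tail
   bound with [u = N1 u2]. *)
pose bad j j' := [set w | N1%:R * u2 <= \sum_(k <- s) a j j' k w /\
   h0 * (\sum_(k <- s) a j j' k w) < `|\sum_(k <- s) a j j' k w * eta k j' w|].
pose c := 2 * expR (- (expR (- 2 * beta) * (N1%:R * u2) * h0 ^+ 2 / 4)).
have bad_tail (j j' : 'I_(N0 + N1 + N2)) : (j' < N0)%N ->
    measurable (bad j j') /\ (P (bad j j') <= c%:E)%E.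
  move=> j'N0.
  apply: (@weighted_noise_tail _ _ _ P _ Q (a j j') (fun k => eta k j') beta hbeta).
  - by move=> k w; exact: acoef_ge0_le1.
  - by move=> k _; exact: measurable_acoef.
  - by [].
  - by move=> k; have [] := eta_mom k j'.
  - by move=> k; have [] := eta_mom k j'.
  - move=> k Qk; exists (cylinders X eta Y (k, j') finset.setT); split.
    + exact: (cylinders_measurable hmodel).
    + apply: (noise_independent_data hmodel hPhi_meas _ (k, j')).
      by move=> x y; have [] := hPhi01 x y.
    + move=> k' _; apply: measurable_acoef => //.
      * exact: measurable_cylinders_X.
      * move=> i l hl; apply: measurable_cylinders_eta.
        (* The weights read noises in columns [l >= N0 + N1], while the omitted noise lies in column
           [j' < N0]. *)
        apply/eqP => -[_ lj']; move: hl.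
        by rewrite lj' leqNgt (leq_trans j'N0) ?leq_addr.
      * by move=> i l; apply: measurable_cylinders_Y; rewrite finset.in_setT.
    + move=> k' _ k'k; apply: measurable_cylinders_eta.
      by apply: contraNneq k'k => -[->].
  - by rewrite filter_uniq// index_enum_uniq.
  - exact: filter_all.
  - by rewrite h0_gt0 ltW.
have sumE (F : 'I_(N0 + N1 + N2) -> R) :
    \sum_(k <- s) F k = \sum_(k < N0 + N1 + N2 | Q k) F k by rewrite big_filter.
have badE j j' w : bad j j' w <->
  (u2 <= Wjj N0 N1 N2 distM X eta Y psi1 b rho L sigma j j' w /\
   h0 < `|Q2jj N0 N1 N2 distM X eta Y psi1 b rho L sigma j j' w|).
  rewrite /bad /= /Q2jj /V2jj /Wjj !sumE.
  set S := \sum_(k < _ | Q k) a j j' k w; rewrite -/S.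
  set V := \sum_(k < _ | Q k) a j j' k w * eta k j' w; rewrite -/V.
  have a0 k : 0 <= a j j' k w.
    have a01 : 0 <= a j j' k w <= 1 by exact: acoef_ge0_le1.
    by case/andP: a01.
  have S0 : 0 <= S by exact: sumr_ge0.
  (* If the weights sum to zero they all vanish, so [V = 0] and the quotient takes the default value
     [0]; as [h0 > 0], both sides are false. *)
  have [SE|S_neq0] := eqVneq S 0.
    have VE : V = 0.
      apply: big1 => k Qk; rewrite (_ : a j j' k w = 0) ?mul0r//.
      by apply: (psumr_eq0P _ SE) => // i _; exact: a0.
    by rewrite SE VE !mulr0 mul0r normr0; split => -[]; lra.
  have S_gt0 : 0 < S by rewrite lt_neqAle eq_sym S_neq0.
  (* An empty [I1] would make [S] an empty sum, contradicting [S != 0]; hence [N1] can be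
     cancelled. *)
  have [N10|N1_gt0] := posnP N1.
    suff SE : S = 0 by rewrite SE eqxx in S_neq0.
    apply: big1 => k /andP[k0 k1]; have := leq_ltn_trans k0 k1.
    by rewrite N10 addn0 ltnn.
  have N1R : 0 < N1%:R :> R by rewrite ltr0n.
  rewrite ler_pdivlMl// -mulf_div divff ?invr_eq0 ?gt_eqF// mul1r.
  by rewrite normrM normfV (gtr0_norm S_gt0) ltr_pdivlMr.
(* Indexing the union by ['I_N0 * 'I_N0] makes the number of failure events exactly [N0 ^ 2]. *)
pose wd := @widen_ord N0 (N0 + N1 + N2) (leq_trans (leq_addr _ _) (leq_addr _ _)).
pose U := \big[setU/set0]_(p <- index_enum ('I_N0 * 'I_N0)%type) bad (wd p.1) (wd p.2).
have mbad (p : 'I_N0 * 'I_N0) := (bad_tail (wd p.1) (wd p.2) (ltn_ord p.2)).1.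
have [mU PU] := measurable_bigsetU_le_sum P _ (index_enum ('I_N0 * 'I_N0)%type) _ mbad.
have goodE : good = ~` U.
  rewrite /U -bigcup_seq; apply/seteqP; split => w.
    move=> gw [p _ /badE[uW hQ]].
    by have := gw (wd p.1) (wd p.2) (ltn_ord p.1) (ltn_ord p.2) uW; rewrite leNgt hQ.
  move=> nU j j' jN0 j'N0 uW; rewrite leNgt; apply/negP => hQ; apply: nU.
  exists (Ordinal jN0, Ordinal j'N0); first by rewrite /= mem_index_enum.
  have -> : wd (Ordinal jN0, Ordinal j'N0).1 = j by exact: val_inj.
  have -> : wd (Ordinal jN0, Ordinal j'N0).2 = j' by exact: val_inj.
  exact/badE.
rewrite goodE /pr probability_setC//.
have PU' : (P U <= ((N0 ^ 2)%:R * c)%:E)%E.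
  apply: (le_trans PU).
  apply: (@le_trans _ _ (\sum_(p : 'I_N0 * 'I_N0) c%:E)%E).
    by apply: lee_sum => p _; exact: (bad_tail (wd p.1) (wd p.2) (ltn_ord p.2)).2.
  by rewrite sumEFin sumr_const card_prod card_ord lee_fin mulr_natl mulnn.
move: PU'; rewrite -(@fineK _ (P U)) ?fin_num_measure// lee_fin => PU'.
rewrite -EFinB/= lerD2l lerN2 (le_trans PU')// /c.
by rewrite mulrCA !mulrA lexx.
Qed.
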